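(* Suppose $w\mapsto L_w\in\otimes^4\mathfrak h$, defined for all words $w$ on $\{0,1\}$, is a coherent choice of tensors, i.e. $\mathscr D(L_{w0},L_{w1})=\mathscr Y(L_w)$ for every word $w$. Then $t\mapsto T^L_t$ defines a scale invariant operator on the direct system $A_Y$; that is, $T^L_t\circ\iota_s^t=\iota_s^t\circ T^L_s$ for all $s\le t$ in $\mathfrak T$.
   Context: $\mathfrak h$ is a finite dimensional complex Hilbert space with a fixed orthonormal basis $(e_i)$, and $Y:\mathfrak h\to\mathfrak h\otimes\mathfrak h$ is a linear isometry, $Y e_b=\sum_{x,y}Y_{b,x,y}\,e_x\otimes e_y$. $\mathfrak T$ is the directed set of planar binary rooted trees, with $s\le t$ iff $s$ is a rooted subtree of $t$. The direct system $A_Y$ assigns to a tree $t$ with $k$ leaves the Hilbert space $\mathcal H_t=\otimes^k\mathfrak h$. If $t$ is obtained from $s$ by attaching a binary branching at the $i$-th leaf (from the left), then $\iota_s^t=\mathrm{id}^{\otimes(i-1)}\otimes Y\otimes\mathrm{id}^{\otimes(k-i)}$; general $\iota_s^t$ are compositions of these. An element $L\in\otimes^4\mathfrak h$ has components $L_{i,j,k,\ell}$; it is drawn as a 4-valent vertex with legs north, east, south, west carrying $i,j,k,\ell$. For $L_1,\dots,L_k\in\otimes^4\mathfrak h$ the transfer matrix with periodic boundary conditions is the operator on $\otimes^k\mathfrak h$ given by $$T(L_1,\dots,L_k)(e_{s_1}\otimes\cdots\otimes e_{s_k})=\sum_{n_1,\dots,n_k}\ \sum_{w_1,\dots,w_k}\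 \prod_{i=1}^k (L_i)_{n_i,\,w_{i+1},\,s_i,\,w_i}\ e_{n_1}\otimes\cdots\otimes e_{n_k},\qquad w_{k+1}:=w_1 .$$ Each leaf of a tree is coded by the word on $\{0,1\}$ read from the path from root to leaf, $0$ for a left turn and $1$ for a right turn. For a function $w\mapsto L_w$ and a tree $t$ whose leaves, from left to right, have words $w_1,\dots,w_k$, put $T^L_t=T(L_{w_1},\dots,L_{w_k})$ on $\mathcal H_t$. The tensors $\mathscr D(A,B),\mathscr Y(C)\in\otimes^5\mathfrak h$ are $$\mathscr D(A,B)_{b,w,n_1,n_2,e}=\sum_{x,y,m}Y_{b,x,y}\,A_{n_1,m,x,w}\,B_{n_2,e,y,m},\qquad \mathscr Y(C)_{b,w,n_1,n_2,e}=\sum_p C_{p,e,b,w}\,Y_{p,n_1,n_2}.$$ *)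

(* Defs.v *)
From HB Require Import structures.
From mathcomp Require Import all_boot all_order all_algebra.

Set Implicit Arguments.
Unset Strict Implicit.
Unset Printing Implicit Defensive.

Import Order.TTheory GRing.Theory Num.Theory.
Local Open Scope ring_scope.

Section Tensors.
Variables (C : numClosedFieldType) (d : nat).

(* The k-th tensor power of h = C^d, in coordinates: the coefficient at the
   multi-index (i_1, ..., i_k) is the one of e_{i_1} (x) ... (x) e_{i_k}.
   In particular h itself is [tens 1]. *)
Definition tens (k : nat) : lmodType C := {ffun k.-tuple 'I_d -> C^o}.

Definition coef k (v : tens k) (s : k.-tuple 'I_d) : C :=
  (v : {ffun k.-tuple 'I_d -> C^o}) s.

Definition mk_tens k (f : k.-tuple 'I_d -> C) : tens k :=
  [ffun s => f s : C^o].

Definition ebasis k (s : k.-tuple 'I_d) : tens k :=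
  mk_tens (fun u => (u == s)%:R).

Definition lin_ext k (V : lmodType C) (f : k.-tuple 'I_d -> V) (v : tens k) : V :=
  \sum_s coef v s *: f s.

Lemma lin_ext_is_linear k (V : lmodType C) (f : k.-tuple 'I_d -> V) :
  linear (lin_ext f).
Proof.
move=> a u v; rewrite /lin_ext scaler_sumr -big_split /=; apply: eq_bigr => s _.
by rewrite /coef !ffunE scalerDl scalerA.
Qed.

HB.instance Definition _ k (V : lmodType C) (f : k.-tuple 'I_d -> V) :=
  GRing.isLinear.Build C (tens k) V _ (lin_ext f) (lin_ext_is_linear f).

Definition inner k (u v : tens k) : C := \sum_s (coef u s)^* * coef v s.

Definition hnorm k (v : tens k) : C := sqrtC (inner v v).

Definition isometric k m (f : tens k -> tens m) : Prop :=
  forall v, hnorm (f v) = hnorm v.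

(* Legs north, east, south, west. *)
Definition comp4 (L : tens 4) (n e s w : 'I_d) : C := coef L [tuple n; e; s; w].

Definition transfer k (L : k.-tuple (tens 4)) : {linear tens k -> tens k} :=
  lin_ext (fun s : k.-tuple 'I_d =>
    \sum_(n : k.-tuple 'I_d) \sum_(w : k.-tuple 'I_d)
      (\prod_(i < k) comp4 (tnth L i)
         (tnth n i) (tnth w (ordS i)) (tnth s i) (tnth w i)) *: ebasis n).

Section Isometry.
Variable Y : {linear tens 1 -> tens 2}.

Definition compY (b x y : 'I_d) : C := coef (Y (ebasis [tuple b])) [tuple x; y].

(* Multi-indices of the 5-tensors are ordered (b, w, n1, n2, e). *)
Definition mk_tens5 (f : 'I_d -> 'I_d -> 'I_d -> 'I_d -> 'I_d -> C) : tens 5 :=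
  mk_tens (fun u : 5.-tuple 'I_d =>
    f (tnth u 0) (tnth u 1) (tnth u 2%R) (tnth u 3%R) (tnth u 4%R)).

Definition tensD (A B : tens 4) : tens 5 :=
  mk_tens5 (fun b w n1 n2 e =>
    \sum_x \sum_y \sum_m compY b x y * comp4 A n1 m x w * comp4 B n2 e y m).

Definition tensY (L : tens 4) : tens 5 :=
  mk_tens5 (fun b w n1 n2 e => \sum_p comp4 L p e b w * compY p n1 n2).

End Isometry.
End Tensors.

Inductive tree : Type := Leaf | Node of tree & tree.

Fixpoint subtree (s t : tree) : bool :=
  match s, t with
  | Leaf, _ => true
  | Node s1 s2, Node t1 t2 => subtree s1 t1 && subtree s2 t2
  | Node _ _, Leaf => false
  end.

(* false is 0 (left turn), true is 1 (right turn). *)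
Fixpoint leaf_words (t : tree) : seq (seq bool) :=
  match t with
  | Leaf => [:: [::]]
  | Node l r => map (cons false) (leaf_words l) ++ map (cons true) (leaf_words r)
  end.

Definition nleaves (t : tree) : nat := size (leaf_words t).

(* Leaves are numbered from 0, left to right. *)
Fixpoint attach (t : tree) (i : nat) : tree :=
  match t with
  | Leaf => Node Leaf Leaf
  | Node l r => if (i < nleaves l)%N then Node (attach l i) r
                else Node l (attach r (i - nleaves l))
  end.

Lemma nleaves_node l r : nleaves (Node l r) = (nleaves l + nleaves r)%N.
Proof. by rewrite /nleaves /= size_cat !size_map. Qed.

Lemma nleaves_attach t i : nleaves (attach t i) = (nleaves t).+1.
Proof.
elim: t i => [|l IHl r IHr] i //=.
by case: ifP => _; rewrite !nleaves_node ?IHl ?IHr ?addSn ?addnS.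
Qed.

Lemma size_branch d t (i : 'I_(nleaves t)) (s : (nleaves t).-tuple 'I_d) x y :
  size (take i s ++ [:: x, y & drop i.+1 s]) == nleaves (attach t i).
Proof.
have lti := ltn_ord i.
rewrite nleaves_attach size_cat /= size_drop size_take size_tuple lti.
by rewrite !addnS -addSn subnKC.
Qed.

Definition branch_tuple d t (i : 'I_(nleaves t)) (s : (nleaves t).-tuple 'I_d)
    (x y : 'I_d) : (nleaves (attach t i)).-tuple 'I_d :=
  Tuple (size_branch i s x y).

Lemma subtree_attach s t i : subtree s t -> subtree s (attach t i).
Proof.
elim: s t i => [|s1 IH1 s2 IH2] [|l r] i //= /andP[sl sr].
by case: ifP => _ /=; rewrite ?sl ?sr ?IH1 ?IH2.
Qed.

Section DirectSystem.
Variables (C : numClosedFieldType) (d : nat).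
Local Notation tens := (tens C d).
Variable Y : {linear tens 1 -> tens 2}.

Definition hilb (t : tree) : lmodType C := tens (nleaves t).

(* id (x) ... (x) Y (x) ... (x) id, with Y acting on the tensor factor i. *)
Definition branch_map t (i : 'I_(nleaves t)) :
    {linear hilb t -> hilb (attach t i)} :=
  lin_ext (fun s : (nleaves t).-tuple 'I_d =>
    \sum_x \sum_y compY Y (tnth s i) x y *: ebasis C (branch_tuple i s x y)).

(* [connecting f] holds iff f is a composition of maps [branch_map] leading
   from s to t, that is, f is the connecting map iota_s^t of the system. *)
Inductive connecting (s : tree) :
    forall t : tree, {linear hilb s -> hilb t} -> Prop :=
| connecting_refl : connecting (idfun : {linear hilb s -> hilb s})
| connecting_step t (f : {linear hilb s -> hilb t}) (i : 'I_(nleaves t)) :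
    connecting f ->
    connecting (branch_map i \o f : {linear hilb s -> hilb (attach t i)}).

Lemma connecting_trans r s t (g : {linear hilb r -> hilb s})
    (f : {linear hilb s -> hilb t}) : connecting g -> connecting f ->
  exists h : {linear hilb r -> hilb t}, connecting h /\ h =1 f \o g.
Proof.
move=> cg; elim=> [|{}t {}f i _ [h [ch hE]]]; first by exists g.
exists (branch_map i \o h : {linear _ -> _}).
by split=> [|v]; [exact: connecting_step | rewrite /= hE].
Qed.

Lemma connecting_congr s t (f : {linear hilb s -> hilb t}) (F : tree -> tree) k :
    (forall u i, (i < nleaves u)%N -> (i + k < nleaves (F u))%N /\
       attach (F u) (i + k) = F (attach u i)) ->
  connecting f -> exists g : {linear hilb (F s) -> hilb (F t)}, connecting g.
Proof.
move=> FP; elim=> [|{f}t f i _ [g cg]].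
  by exists (idfun : {linear _ -> _}); exact: connecting_refl.
have [lti eqF] := FP t i (ltn_ord i); rewrite -eqF.
by eexists; exact: (connecting_step (Ordinal lti) cg).
Qed.

Lemma connecting_subtree s t (f : {linear hilb s -> hilb t}) :
  connecting f -> subtree s t.
Proof.
elim=> [|{f}t _ i _ st]; last exact: subtree_attach.
by elim: s {f} => //= l -> r ->.
Qed.

Lemma connecting_exists s t :
  subtree s t -> exists f : {linear hilb s -> hilb t}, connecting f.
Proof.
have ctrans s1 s2 s3 : (exists f : {linear hilb s1 -> hilb s2}, connecting f) ->
    (exists f : {linear hilb s2 -> hilb s3}, connecting f) ->
  exists f : {linear hilb s1 -> hilb s3}, connecting f.
  by move=> [f cf] [g cg]; have [h [ch _]] := connecting_trans cf cg; exists h.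
have cnode s1 s2 t1 t2 : (exists f : {linear hilb s1 -> hilb t1}, connecting f) ->
    (exists f : {linear hilb s2 -> hilb t2}, connecting f) ->
  exists f : {linear hilb (Node s1 s2) -> hilb (Node t1 t2)}, connecting f.
  move=> [f cf] [g cg]; apply: (@ctrans _ (Node t1 s2)).
    apply: (connecting_congr (F := Node^~ s2) (k := 0) _ cf) => u i lti.
    by rewrite addn0 /= lti nleaves_node ltn_addr.
  apply: (connecting_congr (F := Node t1) (k := nleaves t1) _ cg) => u i lti.
  by rewrite nleaves_node addnC ltn_add2l lti /= ltnNge leq_addr /= addKn.
have cleaf u : exists f : {linear hilb Leaf -> hilb u}, connecting f.
  elim: u => [|l IHl r IHr].
    by exists (idfun : {linear _ -> _}); exact: connecting_refl.
  apply: (@ctrans _ (Node Leaf Leaf)); last exact: cnode.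
  eexists.
  exact: (connecting_step (ord0 : 'I_(nleaves Leaf)) (connecting_refl _)).
elim: s t => [|s1 IH1 s2 IH2] [|t1 t2] //= /andP[st1 st2].
by apply: cnode; [exact: IH1 | exact: IH2].
Qed.

Definition scale_invariant (T : forall t, {linear hilb t -> hilb t}) : Prop :=
  forall s t, subtree s t ->
  forall iota : {linear hilb s -> hilb t}, connecting iota ->
  T t \o iota =1 iota \o T s.

Definition coherent (L : seq bool -> tens 4) : Prop :=
  forall w, tensD Y (L (rcons w false)) (L (rcons w true)) = tensY Y (L w).

Definition tree_transfer (L : seq bool -> tens 4) (t : tree) :
    {linear hilb t -> hilb t} :=
  transfer (map_tuple L (in_tuple (leaf_words t))).

End DirectSystem.

(* Main.v *)
Require Import Defs.
From HB Require Import structures.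
From mathcomp Require Import all_boot all_order all_algebra.
From mathcomp Require Import complex reals.

Set Implicit Arguments.
Unset Strict Implicit.
Unset Printing Implicit Defensive.

Import Order.TTheory GRing.Theory Num.Theory.
Local Open Scope ring_scope.

(** Connecting maps are composed of the elementary maps that apply [Y] at one
leaf, so it suffices to commute the transfer matrices with one of those
([transfer_branch]).

The idea is to sum out the horizontal indices by reading each vertex, with its
north and south legs fixed, as a matrix from its west index to its east index
([vertex_mx]).  The periodic boundary condition then closes the row of vertices
into a trace: the matrix entries of the transfer matrix are traces of ordered
products of these matrices ([coef_transfer], from [mxtrace_prod]).

Branching a leaf with word [w] replaces [w] by [w0], [w1] and leaves the words
before and after it alone ([leaf_words_attach]).  Hence, for fixed outer north
and south indices, both sides of the commutation have the form tr (P X Q) with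
the same [P] and [Q] coming from the untouched leaves.  On one side [X] is the
product of the matrices of [L w0] and [L w1] with [Y] plugged in from the
south, on the other it is the matrix of [L w] with [Y] plugged in from the
north.  That these two matrices agree is exactly the coherence condition, whose
legs [w] and [e] are the row and column indices ([coherence_mx]). *)

(** * Cyclic sums as traces *)

Section CyclicTrace.
Variables (R : comNzRingType) (d : nat).

Lemma sum_tuple_cons k (F : k.+1.-tuple 'I_d -> R) :
  \sum_w F w = \sum_a \sum_(w : k.-tuple 'I_d) F [tuple of a :: w].
Proof.
rewrite pair_bigA /=.
rewrite (reindex (fun p : 'I_d * k.-tuple 'I_d => [tuple of p.1 :: p.2])) //.
exists (fun w : k.+1.-tuple 'I_d => (thead w, [tuple of behead w]))
  => [[a w] _|w _] /=.
  by rewrite theadE; congr (_, _); apply: val_inj.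
by rewrite -tuple_eta.
Qed.

(** The path expansion of an entry of a product: the path visits [a], then the
entries of [w], then [b].  The default value [b] of [nth] supplies the last
vertex, which lies one place past the end of [w]. *)
Lemma prod_mx_entry k (M : nat -> 'M[R]_d) a b :
  (\prod_(0 <= j < k.+1) M j) a b =
  \sum_(w : k.-tuple 'I_d) \prod_(j < k.+1) M j (nth b (a :: w) j) (nth b w j).
Proof.
elim: k M a => [|k IHk] M a.
  rewrite big_nat1 (big_pred1 [tuple]) => [|w]; last exact/esym/eqP/tuple0.
  by rewrite big_ord1.
rewrite big_nat_recl // [LHS]mxE sum_tuple_cons; apply: eq_bigr => c _.
rewrite (IHk (fun j => M j.+1)) big_distrr; apply: eq_bigr => w _ /=.
by rewrite [RHS]big_ord_recl.
Qed.

(** A cyclic word of indices is a closed path.  The word must be nonempty: for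
[k = 0] the left-hand side is 1 and the right-hand side is [d]. *)
Lemma mxtrace_prod k (M : 'I_k -> 'M[R]_d) : (0 < k)%N ->
  \sum_(w : k.-tuple 'I_d) \prod_(i < k) M i (tnth w i) (tnth w (ordS i)) =
  \tr (\prod_(i < k) M i).
Proof.
case: k M => // k M _; pose N j := M (inord j).
have -> : \prod_(i < k.+1) M i = \prod_(0 <= j < k.+1) N j.
  by rewrite big_mkord; apply: eq_bigr => i _; rewrite /N inord_val.
rewrite sum_tuple_cons; apply: eq_bigr => a _; rewrite prod_mx_entry.
apply: eq_bigr => w _; apply: eq_bigr => j _.
rewrite /N inord_val !(tnth_nth a) /=; congr (M _ _ _).
(* The last step of the path returns to its starting point [a]. *)
have [jk|kj] := ltnP j k; first by rewrite modn_small.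
have -> : (j : nat) = k by apply/eqP; rewrite eqn_leq kj -ltnS ltn_ord.
by rewrite modnn [RHS]nth_default // size_tuple.
Qed.

End CyclicTrace.

(** * Coordinates of tensors and of transfer matrices *)

Section Coordinates.
Variables (C : numClosedFieldType) (d : nat).
Local Notation tens := (tens C d).

Lemma coef_sum k I (r : seq I) (F : I -> tens k) n :
  coef (\sum_(j <- r) F j) n = \sum_(j <- r) coef (F j) n.
Proof. by rewrite /coef sum_ffunE. Qed.

Lemma coefZ k a (v : tens k) n : coef (a *: v) n = a * coef v n.
Proof. by rewrite /coef ffunE. Qed.

Lemma coef_ebasis k (s u : k.-tuple 'I_d) : coef (ebasis C s) u = (u == s)%:R.
Proof. by rewrite /coef ffunE. Qed.

Lemma coef_inj k (u v : tens k) : coef u =1 coef v -> u = v.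
Proof. by move=> uv; apply/ffunP. Qed.

Lemma sum_delta (I : finType) (i : I) (F : I -> C) :
  \sum_j F j * (i == j)%:R = F i.
Proof.
rewrite (bigD1 i) //= eqxx mulr1 big1 ?addr0 // => j /negPf.
by rewrite eq_sym => ->; rewrite mulr0.
Qed.

Lemma tens_ebasis k (v : tens k) : v = \sum_s coef v s *: ebasis C s.
Proof.
apply: coef_inj => n; rewrite coef_sum -[LHS](sum_delta n).
by apply: eq_bigr => s _; rewrite coefZ coef_ebasis.
Qed.

Lemma lin_ext_ebasis k (V : lmodType C) (f : k.-tuple 'I_d -> V) s :
  lin_ext f (ebasis C s) = f s.
Proof.
rewrite /lin_ext (bigD1 s) //= coef_ebasis eqxx scale1r big1 ?addr0 // => u.
by rewrite coef_ebasis => /negPf ->; rewrite scale0r.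
Qed.

Lemma linear_eq_ebasis k (V : lmodType C) (f g : {linear tens k -> V}) :
  (forall s, f (ebasis C s) = g (ebasis C s)) -> f =1 g.
Proof.
move=> fg v; rewrite (tens_ebasis v) !linear_sum; apply: eq_bigr => s _.
by rewrite !linearZ /= fg.
Qed.

(** Rows are indexed by the west leg and columns by the east leg, so that the
matrix product glues the east leg of a vertex to the west leg of the next one.
The pair [p.2] holds the north and the south index. *)
Definition vertex_mx (p : tens 4 * ('I_d * 'I_d)) : 'M[C]_d :=
  \matrix_(w, e) comp4 p.1 p.2.1 e p.2.2 w.

Definition row_mxprod (Ls : seq (tens 4)) (n s : seq 'I_d) : 'M[C]_d :=
  \prod_(p <- zip Ls (zip n s)) vertex_mx p.

Lemma row_mxprod_cat L1 L2 n1 n2 s1 s2 :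
  size n1 = size L1 -> size s1 = size L1 ->
  row_mxprod (L1 ++ L2) (n1 ++ n2) (s1 ++ s2) =
  row_mxprod L1 n1 s1 *m row_mxprod L2 n2 s2.
Proof.
move=> sn ss; rewrite /row_mxprod zip_cat ?zip_cat ?big_cat ?sn //.
by rewrite size_zip sn ss minnn.
Qed.

Lemma row_mxprod_cons A Ls a n b s :
  row_mxprod (A :: Ls) (a :: n) (b :: s) =
  vertex_mx (A, (a, b)) *m row_mxprod Ls n s.
Proof. by rewrite /row_mxprod big_cons. Qed.

(** With north and south indices fixed, the sum over the periodic horizontal
indices is the trace of the product of the vertex matrices. *)
Lemma coef_transfer k (Ls : k.-tuple (tens 4)) (s n : k.-tuple 'I_d) :
  (0 < k)%N -> coef (transfer Ls (ebasis C s)) n = \tr (row_mxprod Ls n s).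
Proof.
move=> k0; rewrite /= lin_ext_ebasis coef_sum.
under eq_bigr => u _.
  rewrite coef_sum; under eq_bigr => w _ do rewrite coefZ coef_ebasis.
  rewrite -big_distrl /=; over.
rewrite sum_delta.
pose M i := vertex_mx (tnth Ls i, (tnth n i, tnth s i)).
have -> : row_mxprod Ls n s = \prod_(i < k) M i.
  rewrite /row_mxprod (big_tuple _ _ (zip_tuple Ls (zip_tuple n s))).
  apply: eq_bigr => i _.
  rewrite (tnth_nth (tnth Ls i, (tnth n i, tnth s i))) /=.
  by rewrite !nth_zip ?size_zip ?size_tuple ?minnn // -!tnth_nth.
rewrite -mxtrace_prod //; apply: eq_bigr => w _; apply: eq_bigr => i _.
by rewrite mxE.
Qed.

(** The inner sum over the edge [m] joining [A] to [B] in [tensD] is the one in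
the matrix product, and the legs [w], [e] of the 5-tensors become the row and
column of the two matrices. *)
Lemma coherence_mx (Y : {linear tens 1 -> tens 2}) (A B L : tens 4) b n1 n2 :
  tensD Y A B = tensY Y L ->
  \sum_x \sum_y
    compY Y b x y *: (vertex_mx (A, (n1, x)) *m vertex_mx (B, (n2, y)))
  = \sum_p compY Y p n1 n2 *: vertex_mx (L, (p, b)).
Proof.
move=> AB_L; apply/matrixP => w e.
have := congr1 (fun u => coef u [tuple b; w; n1; n2; e]) AB_L.
rewrite /coef !ffunE !(tnth_nth b) /= => E.
rewrite !summxE; transitivity (\sum_p comp4 L p e b w * compY Y p n1 n2).
  rewrite -E; apply: eq_bigr => x _; rewrite summxE; apply: eq_bigr => y _.
  rewrite !mxE big_distrr; apply: eq_bigr => m _ /=.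
  by rewrite !mxE mulrA.
by apply: eq_bigr => p _; rewrite !mxE mulrC.
Qed.

End Coordinates.

(** * Branching at one leaf *)

Lemma leaf_words_attach t i : (i < nleaves t)%N ->
  exists W1 w W2, [/\ size W1 = i, leaf_words t = W1 ++ w :: W2 &
    leaf_words (attach t i) = W1 ++ rcons w false :: rcons w true :: W2].
Proof.
elim: t i => [|l IHl r IHr] i /=.
  by case: i => // _; exists [::], [::], [::].
rewrite nleaves_node; case: (ltnP i (nleaves l)) => il ilr.
  have [W1 [w [W2 [sW -> /= ->]]]] := IHl _ il.
  exists (map (cons false) W1), (false :: w),
    (map (cons false) W2 ++ map (cons true) (leaf_words r)).
  by rewrite !map_cat size_map -!catA.
have [|W1 [w [W2 [sW -> /= ->]]]] := IHr (i - nleaves l)%N.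
  by rewrite ltn_subLR.
exists (map (cons false) (leaf_words l) ++ map (cons true) W1), (true :: w),
  (map (cons true) W2).
by rewrite !map_cat size_cat !size_map -!catA sW subnKC.
Qed.

Lemma cat_of_size (T : Type) (u : seq T) m k : size u = (m + k)%N ->
  exists u1 u2, [/\ size u1 = m, size u2 = k & u = u1 ++ u2].
Proof.
move=> su; exists (take m u), (drop m u); split.
- by rewrite size_takel // su leq_addr.
- by rewrite size_drop su addKn.
- by rewrite cat_take_drop.
Qed.

Section Branching.
Variables (C : numClosedFieldType) (d : nat).
Variable Y : {linear tens C d 1 -> tens C d 2}.

(** Among the basis tensors of the domain, only those that agree with [n] away
from the branched leaf contribute to the coefficient at [n].  They form the
family [m], indexed by the value [p] carried by that leaf. *)
Lemma coef_branch_map t (i : 'I_(nleaves t)) (v : hilb C d t)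
    (n : (nleaves (attach t i)).-tuple 'I_d) n1 x y n2
    (m : 'I_d -> (nleaves t).-tuple 'I_d) :
    size n1 = i -> n = n1 ++ [:: x, y & n2] :> seq 'I_d ->
    (forall p, m p = n1 ++ p :: n2 :> seq 'I_d) ->
  coef (branch_map Y i v) n = \sum_p compY Y p x y * coef v (m p).
Proof.
move=> sn En Em; rewrite /= /lin_ext coef_sum.
have nE u x' y' : (n == branch_tuple i u x' y') =
    [&& m (tnth u i) == u, y == y' & x == x'].
  have Eu : (u : seq _) = take i u ++ tnth u i :: drop i.+1 u.
    by rewrite (tnth_nth x) -drop_nth ?size_tuple // cat_take_drop.
  have st : size n1 = size (take i u).
    by rewrite size_takel ?size_tuple ?sn // ltnW.
  rewrite -[n == _]val_eqE -[m _ == _]val_eqE /= En Em.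
  rewrite [X in _ = [&& _ == X, _ & _]]Eu.
  rewrite !eqseq_cat ?st // !eqseq_cons eqxx /=.
  by case: (n1 == _); case: (x == _); case: (y == _); case: (n2 == _).
(* A summation over [p], forced by [m p == u] to be the entry of [u] at the
   branched leaf, lets the sum over [u] be evaluated first. *)
transitivity (\sum_u \sum_p (compY Y p x y * coef v u) * (m p == u)%:R).
  apply: eq_bigr => u _; rewrite coefZ coef_sum.
  transitivity (compY Y (tnth u i) x y * coef v u * (m (tnth u i) == u)%:R).
    rewrite mulrC [RHS]mulrAC; congr (_ * _).
    under eq_bigr => x' _.
      rewrite coef_sum; under eq_bigr => y' _.
        rewrite coefZ coef_ebasis nE -!mulnb !natrM !mulrA; over.
      rewrite -big_distrl /= sum_delta; over.
    exact: sum_delta.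
  rewrite -(sum_delta (tnth u i)
    (fun p => compY Y p x y * coef v u * (m p == u)%:R)).
  apply: eq_bigr => p _.
  have [<-|_] := eqVneq (m p) u; last by rewrite mulr0 mul0r.
  by rewrite (tnth_nth p) Em nth_cat sn ltnn subnn eqxx mulr1.
rewrite exchange_big; apply: eq_bigr => p _; exact: sum_delta.
Qed.

(** On basis tensors both sides have coefficients tr (P X Q), where [P] and [Q]
come from the leaves before and after the branched one; coherence identifies
the two middle factors [X]. *)
Lemma transfer_branch (L : seq bool -> tens C d 4) t (i : 'I_(nleaves t)) :
  coherent Y L ->
  tree_transfer L (attach t i) \o branch_map Y i =1
  branch_map Y i \o tree_transfer L t.
Proof.
move=> hL; apply: linear_eq_ebasis => s /=; apply: coef_inj => n.
have [W1 [w [W2 [sW EW EW']]]] := leaf_words_attach (ltn_ord i).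
have szt : nleaves t = (i + (size W2).+1)%N by rewrite -sW /nleaves EW size_cat.
have sza : nleaves (attach t i) = (i + (size W2).+2)%N.
  by rewrite -[in RHS]sW /nleaves EW' size_cat.
have [n1 [[|x [|y n2]] [sn1 //= [sn2] En]]] :=
  cat_of_size (etrans (size_tuple n) sza).
have [s1 [[|b s2] [ss1 //= [ss2] Es]]] :=
  cat_of_size (etrans (size_tuple s) szt).
have t_gt0 : (0 < nleaves t)%N by apply: leq_ltn_trans (ltn_ord i).
have size_m p : size (n1 ++ p :: n2) == nleaves t.
  by rewrite szt size_cat /= sn1 sn2.
rewrite (coef_branch_map _ sn1 En (m := fun p => Tuple (size_m p))) //.
have Eb : branch_map Y i (ebasis C s) =
    \sum_x' \sum_y' compY Y b x' y' *: ebasis C (branch_tuple i s x' y').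
  by rewrite /= lin_ext_ebasis (tnth_nth b) Es nth_cat ss1 ltnn subnn.
set P := row_mxprod (map L W1) n1 s1; set Q := row_mxprod (map L W2) n2 s2.
have size_map1 : size (map L W1) = i by rewrite size_map.
transitivity (\tr (P *m (\sum_x' \sum_y' compY Y b x' y' *:
    (vertex_mx (L (rcons w false), (x, x')) *m
     vertex_mx (L (rcons w true), (y, y')))) *m Q)).
  rewrite Eb linear_sum coef_sum mulmx_sumr mulmx_suml raddf_sum.
  apply: eq_bigr => x' _.
  rewrite linear_sum coef_sum mulmx_sumr mulmx_suml raddf_sum.
  apply: eq_bigr => y' _; rewrite linearZ coefZ coef_transfer ?nleaves_attach //.
  rewrite -scalemxAr -scalemxAl [RHS]mxtraceZ /= En EW' map_cat Es -ss1.
  rewrite take_size_cat // drop_cat ltnNge leqnSn subSnn /= drop0.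
  by rewrite row_mxprod_cat ?ss1 ?sn1 ?size_map1 // !row_mxprod_cons !mulmxA.
rewrite (coherence_mx _ _ _ (hL w)) mulmx_sumr mulmx_suml raddf_sum.
apply: eq_bigr => p _; rewrite coef_transfer //= EW map_cat Es.
rewrite row_mxprod_cat ?ss1 ?sn1 ?size_map1 // row_mxprod_cons.
by rewrite -scalemxAr -scalemxAl [LHS]mxtraceZ mulmxA.
Qed.

End Branching.

Theorem proposition2p13 (R : realType) (d : nat)
    (Y : {linear tens R[i] d 1 -> tens R[i] d 2}) (hY : isometric Y)
    (L : seq bool -> tens R[i] d 4) (hL : coherent Y L) :
  scale_invariant Y (tree_transfer L).
Proof.
move=> s t _ iota; elim=> {t iota}[|t f i _ IHf] v //=.
exact: etrans (transfer_branch i hL (f v)) (congr1 (branch_map Y i) (IHf v)).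
Qed.
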